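(* Let $A\in\mathbb{C}^{n\times n}$ have no eigenvalues on the closed negative real axis $(-\infty,0]$ and let $\alpha\in(0,1)$. For given $\epsilon>0$, let $$l=\operatorname{asinh}\left(\frac{2\log(a)}{\alpha\pi}\right),\qquad r=\operatorname{asinh}\left(\frac{2\log(b)}{\alpha\pi}\right),$$ where $$a=\min\left\{\frac{\epsilon}{4}\,\frac{\pi\alpha(1+\alpha)}{\sin(\alpha\pi)(1+2\alpha)},\ (2\|A^{-1}\|_2)^{-\alpha}\right\},$$ $$b=\max\left\{\left[\frac{\epsilon}{4}\,\frac{\pi(1-\alpha)(2-\alpha)}{\sin(\alpha\pi)(3-2\alpha)\|A\|_2}\right]^{\alpha/(\alpha-1)},\ (2\|A\|_2)^{\alpha}\right\}.$$ Then $$\left\|\int_{-\infty}^{\infty}F_{\mathrm{DE}}(x)\,\mathrm{d}x-\int_l^r F_{\mathrm{DE}}(x)\,\mathrm{d}x\right\|_2\le\frac{\epsilon}{2}.$$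
   Context: $\|\cdot\|_2$ is the matrix 2-norm (spectral norm), $I$ is the $n\times n$ identity matrix, and $\operatorname{asinh}$ is the inverse function of $\sinh$ on $\mathbb{R}$. For $A$ and $\alpha$, define for $t\in(0,\infty)$ $$F(t)=\frac{\sin(\alpha\pi)}{\alpha\pi}\,A\,(t^{1/\alpha}I+A)^{-1},$$ and for $x\in\mathbb{R}$ $$t(x)=\exp(\alpha\pi\sinh(x)/2),\qquad F_{\mathrm{DE}}(x)=t'(x)\,F(t(x)).$$ Integrals of matrix-valued functions are taken entrywise. (The integral $\int_{-\infty}^{\infty}F_{\mathrm{DE}}(x)\,\mathrm{d}x=\int_0^\infty F(t)\,\mathrm{d}t$ equals the principal matrix power $A^\alpha=\exp(\alpha\log A)$.) *)

(* Defs.v *)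
From HB Require Import structures.
From mathcomp Require Import all_boot all_order all_algebra.
From mathcomp Require Import complex.
From mathcomp Require Import all_classical all_reals all_analysis.

Set Implicit Arguments.
Unset Strict Implicit.
Unset Printing Implicit Defensive.

Import Order.TTheory GRing.Theory Num.Theory.
Import numFieldNormedType.Exports.

Local Open Scope classical_set_scope.
Local Open Scope ring_scope.
Local Open Scope complex_scope.

Definition sinh (R : realType) (x : R) : R := (expR x - expR (- x)) / 2.

(* [pinv] picks a preimage; by the two cancellation lemmas below it is the
   two-sided inverse of [sinh] on the whole real line. *)
Definition asinh (R : realType) : R -> R := pinv [set: R] (@sinh R).

Lemma sinh_inj (R : realType) : injective (@sinh R).
Proof.
have mono (x y : R) : x < y -> sinh x < sinh y.
  move=> xy; rewrite /sinh ltr_pM2r ?invr_gt0 ?ltr0n//.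
  by apply: ltrB; rewrite ltr_expR// ltrN2.
move=> x y exy; apply/eqP; rewrite eq_le !leNgt.
by apply/andP; split; apply/negP => /mono; rewrite exy ltxx.
Qed.

Lemma asinhK (R : realType) : cancel (@asinh R) (@sinh R).
Proof.
move=> y; apply: pinvK; rewrite inE; exists (ln (y + Num.sqrt (1 + y ^+ 2))) => //=.
set s := Num.sqrt _.
have s2 : s ^+ 2 = 1 + y ^+ 2 by rewrite sqr_sqrtr// addr_ge0 ?sqr_ge0.
have s0 : 0 <= s by exact: sqrtr_ge0.
have ys : 0 < y + s.
  rewrite -ltrBlDl sub0r; apply: le_lt_trans (ler_norm _) _; rewrite normrN.
  by rewrite -(@ltr_pXn2r _ 2) ?nnegrE// s2 real_normK ?num_real// ltrDr.
rewrite /sinh expRN lnK ?posrE//.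
have -> : (y + s)^-1 = s - y.
  apply: (mulfI (lt0r_neq0 ys)); rewrite divff ?lt0r_neq0//.
  by rewrite (addrC y) mulrC -subr_sqr s2 addrK.
by rewrite opprB addrA addrAC addrK -mulr2n -(mulr_natr y) mulfK// pnatr_eq0.
Qed.

Lemma sinhK (R : realType) : cancel (@sinh R) (@asinh R).
Proof. by move=> x; apply: sinh_inj; rewrite asinhK. Qed.

Definition vec_norm2 (R : realType) (n : nat) (x : 'cV[R[i]]_n) : R :=
  Num.sqrt (\sum_(i < n) ComplexField.Normc.normc (x i 0) ^+ 2).

Definition mx_norm2 (R : realType) (n : nat) (A : 'M[R[i]]_n) : R :=
  sup [set vec_norm2 (A *m x) / vec_norm2 x | x in [set x | x != 0]].

(* The supremum in [mx_norm2] is finite, so that the default value of [sup] is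
   not used except for [n = 0], where it gives the norm 0. *)
Lemma mx_norm2_ub (R : realType) (n : nat) (A : 'M[R[i]]_n) :
  has_ubound [set vec_norm2 (A *m x) / vec_norm2 x | x in [set x | x != 0]].
Proof.
pose N := @ComplexField.Normc.normc R.
have N0 z : 0 <= N z by case: z => u v; exact: sqrtr_ge0.
have S0 (x : 'cV[R[i]]_n) : 0 <= \sum_(i < n) N (x i 0) ^+ 2.
  by apply: sumr_ge0 => i _; exact: sqr_ge0.
pose c (i : 'I_n) := \sum_(j < n) N (A i j).
exists (Num.sqrt (\sum_(i < n) c i ^+ 2)) => _ [x /= x0 <-].
have Nx j : N (x j 0) <= vec_norm2 x.
  rewrite -(@ler_pXn2r _ 2) ?nnegrE ?N0 ?sqrtr_ge0// sqr_sqrtr// (bigD1 j)//=.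
  by rewrite lerDl; apply: sumr_ge0 => i _; exact: sqr_ge0.
have x_gt0 : 0 < vec_norm2 x.
  rewrite lt_neqAle sqrtr_ge0 andbT eq_sym; apply: contraNneq x0 => vx.
  apply/eqP/colP => j; rewrite mxE; apply: ComplexField.Normc.eq0_normc.
  by apply/eqP; rewrite eq_le N0 andbT -vx.
rewrite ler_pdivrMr// -(@ler_pXn2r _ 2) ?nnegrE ?mulr_ge0 ?sqrtr_ge0//.
have C0 : 0 <= \sum_(i < n) c i ^+ 2 by apply: sumr_ge0 => i _; exact: sqr_ge0.
rewrite exprMn [X in _ <= X * _]sqr_sqrtr// [X in X <= _]sqr_sqrtr//.
rewrite mulr_suml; apply: ler_sum => i _; rewrite -exprMn.
rewrite ler_pXn2r ?nnegrE ?N0//; last first.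
  by rewrite mulr_ge0 ?(ltW x_gt0)//; apply: sumr_ge0 => j _; exact: N0.
rewrite mxE mulr_suml.
elim/big_ind2 : _ => [|u u' v v' uu' vv'|j _].
- by rewrite ComplexField.Normc.normc0.
- by apply: le_trans (le_normcD _ _) _; exact: lerD.
- by rewrite ComplexField.Normc.normcM ler_wpM2l.
Qed.

Definition mx_integral (R : realType) (n : nat) (D : set R)
    (G : R -> 'M[R[i]]_n) : 'M[R[i]]_n :=
  \matrix_(i < n, j < n)
    ((\int[lebesgue_measure]_(x in D) complex.Re (G x i j))
     +i* (\int[lebesgue_measure]_(x in D) complex.Im (G x i j))).

Definition F_int (R : realType) (n : nat) (A : 'M[R[i]]_n) (alpha : R)
    (t : R) : 'M[R[i]]_n :=
  (sin (alpha * pi) / (alpha * pi))%:C *: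
    (A *m invmx ((t `^ alpha^-1)%:C%:M + A)).

Definition t_DE (R : realType) (alpha : R) (x : R) : R :=
  expR (alpha * pi * sinh x / 2).

Definition F_DE (R : realType) (n : nat) (A : 'M[R[i]]_n) (alpha : R)
    (x : R) : 'M[R[i]]_n :=
  (derive1 (t_DE alpha) x)%:C *: F_int A alpha (t_DE alpha x).

(* Main.v *)
Require Import Defs.
From mathcomp Require Import all_boot all_order all_algebra.
From mathcomp Require Import complex ring lra.
From mathcomp Require Import all_classical all_reals all_analysis measurable_realfun.

Import Order.TTheory GRing.Theory Num.Theory.
Import numFieldNormedType.Exports.

Set Implicit Arguments.
Unset Strict Implicit.
Unset Printing Implicit Defensive.

Local Open Scope classical_set_scope.
Local Open Scope ring_scope.
Local Open Scope complex_scope.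

Local Notation Re := complex.Re.
Local Notation Im := complex.Im.

(** With t = t(x), both integrals of F_DE are integrals of F over t, so the
    error is the sum of the two tails, over (0, a) and (b, oo). Write
    s = t^(1/alpha), M = |A^-1|, N = |A| and
    c = sin(alpha pi) / (alpha pi), so that F(t) = c A (s I + A)^-1. The second
    arguments of the minimum a and of the maximum b guarantee s M <= 1/2 on the
    left tail and N / s <= 1/2 on the right tail, which is where the resolvent
    has elementary bounds:

      |F(t)| <= c (1 + 2 s M)              for t <= a,
      |F(t)| <= c (N / s) (1 + 2 N / s)    for t >= b.

    They come from one line of algebra each ([resolvent_norm_small] and
    [resolvent_norm_large]) instead of a Neumann series. Integrating these
    powers of t gives at most

      c a (1 + 2 alpha) / (1 + alpha)
      and  c alpha N b^((alpha-1)/alpha)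
             (3 - 2 alpha) / ((1 - alpha) (2 - alpha)),

    and the first arguments of the minimum and of the maximum are exactly what
    makes each of them at most eps / 4.

    The change of variables is never performed on F. The majorants are instead
    pulled back to x, where they are combinations of the functions
    t'(x) t(x)^(q-1), whose primitive t(x)^q / q is explicit
    ([has_Rintegral_de_density_left], [has_Rintegral_de_density_right]).

    Passing from a pointwise bound on the spectral norm to a bound on the norm
    of an entrywise integral is done by duality: for y = (int G) z, the number
    |y|^2 is the integral of the scalar <y, G z>, which Cauchy-Schwarz bounds by
    |y| |G| |z| ([mx_norm2_integral_le]). The majorants also make the entries of
    F_DE integrable on the tails; they are continuous, because s I + A is
    invertible for every s >= 0, hence integrable on [l, r]. So the integral
    over the line splits, provided that l <= r; this follows from N M >= 1
    ([endpoints_le]). *)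

(** * Euclidean norm of complex vectors *)

(** The real part of the Hermitian inner product: it carries the same norm, and
    real-valued integrals are enough to handle it. *)
Definition rdot (R : realType) (n : nat) (x y : 'cV[R[i]]_n) : R :=
  \sum_(i < n) (Re (x i 0) * Re (y i 0) + Im (x i 0) * Im (y i 0)).

Lemma Re_addc (R : realType) (x y : R[i]) : Re (x + y) = Re x + Re y.
Proof. by case: x; case: y. Qed.

Lemma Im_addc (R : realType) (x y : R[i]) : Im (x + y) = Im x + Im y.
Proof. by case: x; case: y. Qed.

Lemma Re_mulc (R : realType) (x y : R[i]) : Re (x * y) = Re x * Re y - Im x * Im y.
Proof. by case: x; case: y. Qed.

Lemma Im_mulc (R : realType) (x y : R[i]) : Im (x * y) = Re x * Im y + Im x * Re y.
Proof. by case: x; case: y. Qed.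

Lemma Re_sumc (R : realType) (I : Type) (s : seq I) (P : pred I) (f : I -> R[i]) :
  Re (\sum_(i <- s | P i) f i) = \sum_(i <- s | P i) Re (f i).
Proof. by apply: (big_morph _ (@Re_addc R)). Qed.

Lemma Im_sumc (R : realType) (I : Type) (s : seq I) (P : pred I) (f : I -> R[i]) :
  Im (\sum_(i <- s | P i) f i) = \sum_(i <- s | P i) Im (f i).
Proof. by apply: (big_morph _ (@Im_addc R)). Qed.

Lemma normc_sqrE (R : realType) (z : R[i]) :
  ComplexField.Normc.normc z ^+ 2 = Re z ^+ 2 + Im z ^+ 2.
Proof. by case: z => u v /=; rewrite sqr_sqrtr// addr_ge0 ?sqr_ge0. Qed.

Lemma vec_norm2_ge0 (R : realType) (n : nat) (x : 'cV[R[i]]_n) :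
  0 <= vec_norm2 x.
Proof. exact: sqrtr_ge0. Qed.

Lemma vec_norm2_sqr (R : realType) (n : nat) (x : 'cV[R[i]]_n) :
  vec_norm2 x ^+ 2 = rdot x x.
Proof.
rewrite sqr_sqrtr; last by apply: sumr_ge0 => i _; exact: sqr_ge0.
by apply: eq_bigr => i _; rewrite normc_sqrE -!expr2.
Qed.

Lemma vec_norm2_eq0 (R : realType) (n : nat) (x : 'cV[R[i]]_n) :
  vec_norm2 x = 0 -> x = 0.
Proof.
move=> x0; have := vec_norm2_sqr x; rewrite x0 expr0n/= => /esym/eqP.
rewrite psumr_eq0; last by move=> i _; rewrite addr_ge0// -expr2 sqr_ge0.
move=> /allP xi0; apply/colP => i; rewrite mxE.
have := xi0 i (mem_index_enum _); rewrite /= -!expr2.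
rewrite paddr_eq0 ?sqr_ge0// !sqrf_eq0.
by case: (x i 0) => u v /= /andP[/eqP -> /eqP ->].
Qed.

Lemma vec_norm2_0 (R : realType) (n : nat) : vec_norm2 (0 : 'cV[R[i]]_n) = 0.
Proof.
apply/eqP; rewrite sqrtr_eq0 big1// => i _.
by rewrite mxE ComplexField.Normc.normc0 expr0n.
Qed.

Lemma vec_norm2_gt0 (R : realType) (n : nat) (x : 'cV[R[i]]_n) :
  x != 0 -> 0 < vec_norm2 x.
Proof.
by rewrite lt_def vec_norm2_ge0 andbT; apply: contra_neq => /vec_norm2_eq0.
Qed.

Lemma vec_norm2Z (R : realType) (n : nat) (c : R) (x : 'cV[R[i]]_n) :
  vec_norm2 (c%:C *: x) = `|c| * vec_norm2 x.
Proof.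
rewrite /vec_norm2 -sqrtr_sqr -sqrtrM ?sqr_ge0//; congr Num.sqrt.
rewrite mulr_sumr; apply: eq_bigr => i _; rewrite !normc_sqrE mxE Re_mulc Im_mulc /=.
ring.
Qed.

(** Expanding the square of the norm of |y| x - |x| y, which is nonnegative. *)
Lemma rdot_le (R : realType) (n : nat) (x y : 'cV[R[i]]_n) :
  rdot x y <= vec_norm2 x * vec_norm2 y.
Proof.
set a := vec_norm2 x; set b := vec_norm2 y.
have [->|x0] := eqVneq x 0.
  rewrite /a /rdot big1 ?mulr_ge0 ?vec_norm2_ge0// => i _.
  by rewrite mxE /= !mul0r addr0.
have [->|y0] := eqVneq y 0.
  rewrite /b /rdot big1 ?mulr_ge0 ?vec_norm2_ge0// => i _.
  by rewrite mxE /= !mulr0 addr0.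
have ab : 0 < a * b by rewrite mulr_gt0 ?vec_norm2_gt0.
suff : 0 <= 2 * (a * b) * (a * b - rdot x y).
  by rewrite pmulr_rge0 ?subr_ge0// mulr_gt0.
have -> : 2 * (a * b) * (a * b - rdot x y) =
    \sum_(i < n) ((b * Re (x i 0) - a * Re (y i 0)) ^+ 2
                  + (b * Im (x i 0) - a * Im (y i 0)) ^+ 2).
  transitivity (b ^+ 2 * rdot x x + a ^+ 2 * rdot y y
                - 2 * (a * b) * rdot x y).
    by rewrite -!vec_norm2_sqr -/a -/b; ring.
  rewrite /rdot !mulr_sumr -big_split -sumrB /=.
  by apply: eq_bigr => i _; ring.
by apply: sumr_ge0 => i _; rewrite addr_ge0 ?sqr_ge0.
Qed.

Lemma vec_norm2D (R : realType) (n : nat) (x y : 'cV[R[i]]_n) :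
  vec_norm2 (x + y) <= vec_norm2 x + vec_norm2 y.
Proof.
rewrite -(@ler_pXn2r _ 2) ?nnegrE ?addr_ge0 ?vec_norm2_ge0//.
have -> : vec_norm2 (x + y) ^+ 2 =
    vec_norm2 x ^+ 2 + vec_norm2 y ^+ 2 + 2 * rdot x y.
  rewrite !vec_norm2_sqr /rdot mulr_sumr -!big_split /=.
  by apply: eq_bigr => i _; rewrite !mxE Re_addc Im_addc; ring.
by have := rdot_le x y; lra.
Qed.

(** * Spectral norm *)

Lemma vec_norm2_mulmx (R : realType) (n : nat) (A : 'M[R[i]]_n)
    (x : 'cV[R[i]]_n) :
  vec_norm2 (A *m x) <= mx_norm2 A * vec_norm2 x.
Proof.
have [->|x0] := eqVneq x 0; first by rewrite mulmx0 vec_norm2_0 mulr0.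
rewrite -ler_pdivrMr ?vec_norm2_gt0//.
by apply: ub_le_sup; [exact: mx_norm2_ub | exists x].
Qed.

Lemma mx_norm2_le (R : realType) (n : nat) (A : 'M[R[i]]_n) (c : R) :
  0 <= c -> (forall x, vec_norm2 (A *m x) <= c * vec_norm2 x) ->
  mx_norm2 A <= c.
Proof.
move=> c0 Ac; rewrite /mx_norm2; set S := [set _ | _ in _].
have [->|/set0P S0] := eqVneq S set0; first by rewrite sup0.
apply: ge_sup => // _ [x x0 <-].
by rewrite ler_pdivrMr ?vec_norm2_gt0.
Qed.

Lemma mx_norm2_ge0 (R : realType) (n : nat) (A : 'M[R[i]]_n) : 0 <= mx_norm2 A.
Proof.
rewrite /mx_norm2; set S := [set _ | _ in _].
have [->|/set0P[_ [x x0 _]]] := eqVneq S set0; first by rewrite sup0.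
apply: (@le_trans _ _ (vec_norm2 (A *m x) / vec_norm2 x)).
  by rewrite divr_ge0 ?vec_norm2_ge0.
by apply: ub_le_sup; [exact: mx_norm2_ub | exists x].
Qed.

(** The entry A i j is a coordinate of the image of a unit basis vector. *)
Lemma normc_entry_le (R : realType) (n : nat) (A : 'M[R[i]]_n) (i j : 'I_n) :
  ComplexField.Normc.normc (A i j) <= mx_norm2 A.
Proof.
pose e : 'cV[R[i]]_n := delta_mx j 0.
have e1 : vec_norm2 e = 1.
  rewrite /vec_norm2 (bigD1 j)//= big1 ?addr0 => [|k kj].
    by rewrite mxE !eqxx ComplexField.Normc.normc1 expr1n sqrtr1.
  by rewrite mxE (negbTE kj) ComplexField.Normc.normc0 expr0n.
have := vec_norm2_mulmx A e; rewrite e1 mulr1.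
apply: le_trans; rewrite -colE.
rewrite -(@ler_pXn2r _ 2) ?nnegrE ?vec_norm2_ge0//; last first.
  by case: (A i j) => u v; exact: sqrtr_ge0.
rewrite vec_norm2_sqr /rdot (bigD1 i)//= normc_sqrE mxE -!expr2 lerDl.
by apply: sumr_ge0 => k _; rewrite -!expr2 addr_ge0 ?sqr_ge0.
Qed.

Lemma normr_Re_le (R : realType) (n : nat) (A : 'M[R[i]]_n) (i j : 'I_n) :
  `|Re (A i j)| <= mx_norm2 A.
Proof.
apply: le_trans (normc_entry_le A i j).
case: (A i j) => u v /=; rewrite -sqrtr_sqr ler_wsqrtr// lerDl sqr_ge0//.
Qed.

Lemma normr_Im_le (R : realType) (n : nat) (A : 'M[R[i]]_n) (i j : 'I_n) :
  `|Im (A i j)| <= mx_norm2 A.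
Proof.
apply: le_trans (normc_entry_le A i j).
case: (A i j) => u v /=; rewrite -sqrtr_sqr ler_wsqrtr// lerDr sqr_ge0//.
Qed.

Lemma mx_norm2D (R : realType) (n : nat) (A B : 'M[R[i]]_n) :
  mx_norm2 (A + B) <= mx_norm2 A + mx_norm2 B.
Proof.
apply: mx_norm2_le => [|x]; first by rewrite addr_ge0 ?mx_norm2_ge0.
rewrite mulmxDl mulrDl; apply: le_trans (vec_norm2D _ _) _.
by rewrite lerD ?vec_norm2_mulmx.
Qed.

Lemma mx_norm2Z_le (R : realType) (n : nat) (c : R) (A : 'M[R[i]]_n) :
  0 <= c -> mx_norm2 (c%:C *: A) <= c * mx_norm2 A.
Proof.
move=> c0; apply: mx_norm2_le => [|x]; first by rewrite mulr_ge0 ?mx_norm2_ge0.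
by rewrite -scalemxAl vec_norm2Z ger0_norm// -mulrA ler_wpM2l ?vec_norm2_mulmx.
Qed.

(** The norm of I = A A^-1 is 1 in positive dimension. *)
Lemma mx_norm2_invmx_ge1 (R : realType) (n : nat) (A : 'M[R[i]]_n) :
  (0 < n)%N -> A \in unitmx -> 1 <= mx_norm2 A * mx_norm2 (invmx A).
Proof.
move=> n0 uA; pose x : 'cV[R[i]]_n := const_mx 1.
have x0 : 0 < vec_norm2 x.
  apply: vec_norm2_gt0; apply/eqP => /colP/(_ (Ordinal n0))/eqP.
  by rewrite !mxE oner_eq0.
rewrite -(ler_pM2r x0) mul1r -[in leLHS](mul1mx x) -(mulmxV uA) -mulmxA.
apply: le_trans (vec_norm2_mulmx _ _) _.
by rewrite -mulrA ler_wpM2l ?mx_norm2_ge0// vec_norm2_mulmx.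
Qed.

Lemma mx_norm2_gt0 (R : realType) (n : nat) (A : 'M[R[i]]_n) :
  (0 < n)%N -> A \in unitmx -> 0 < mx_norm2 A.
Proof.
move=> n0 uA; rewrite lt_def mx_norm2_ge0 andbT.
apply: contraTneq (mx_norm2_invmx_ge1 n0 uA) => ->.
by rewrite mul0r ler10.
Qed.

(** * Norm of an entrywise integral *)

(** Pairing the integrability of a function with the value of its integral lets
    linear combinations be integrated by following their syntax. *)
Definition has_Rintegral (R : realType) (D : set R) (f : R -> R) (v : R) :=
  (@lebesgue_measure R).-integrable D (EFin \o f)
  /\ \int[lebesgue_measure]_(x in D) f x = v.

Lemma has_RintegralD (R : realType) (D : set R) (f g : R -> R) (u v : R) :
  measurable D -> has_Rintegral D f u -> has_Rintegral D g v ->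
  has_Rintegral D (fun x => f x + g x) (u + v).
Proof.
move=> mD [fi <-] [gi <-]; split; last by rewrite RintegralD.
rewrite (_ : EFin \o _ = (EFin \o f) \+ (EFin \o g))%E; last exact/funext.
exact: integrableD.
Qed.

Lemma has_RintegralZ (R : realType) (D : set R) (f : R -> R) (c v : R) :
  measurable D -> has_Rintegral D f v ->
  has_Rintegral D (fun x => c * f x) (c * v).
Proof.
move=> mD [fi <-]; split; last by rewrite RintegralZl.
rewrite (_ : EFin \o _ = (fun x => c%:E * (EFin \o f) x)%E); last exact/funext.
exact: integrableZl.
Qed.

Lemma has_Rintegral_sum (R : realType) (D : set R) (I : Type) (s : seq I)
    (f : I -> R -> R) (v : I -> R) :
  measurable D -> (forall i, has_Rintegral D (f i) (v i)) ->
  has_Rintegral D (fun x => \sum_(i <- s) f i x) (\sum_(i <- s) v i).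
Proof.
move=> mD fv; elim: s => [|i s ih].
  rewrite big_nil (_ : (fun x => _) = cst 0); last first.
    by apply/funext => x; rewrite big_nil.
  by split; [exact: integrable0 | rewrite Rintegral_cst// mul0r].
rewrite big_cons (_ : (fun x => _) = fun x => f i x + \sum_(i <- s) f i x).
  exact: has_RintegralD.
by apply/funext => x; rewrite big_cons.
Qed.

Lemma le_has_Rintegral (R : realType) (D : set R) (f g : R -> R) (u v : R) :
  measurable D -> has_Rintegral D f u -> has_Rintegral D g v ->
  (forall x, D x -> f x <= g x) -> u <= v.
Proof. by move=> mD [fi <-] [gi <-] fg; exact: le_Rintegral. Qed.

Lemma has_Rintegral_rdot (R : realType) (n : nat) (D : set R)
    (G : R -> 'M[R[i]]_n) (y z : 'cV[R[i]]_n) :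
  measurable D ->
  (forall i j, (@lebesgue_measure R).-integrable D
                 (EFin \o (fun x => Re (G x i j)))) ->
  (forall i j, (@lebesgue_measure R).-integrable D
                 (EFin \o (fun x => Im (G x i j)))) ->
  has_Rintegral D (fun x => rdot y (G x *m z)) (rdot y (mx_integral D G *m z)).
Proof.
move=> mD iRe iIm; apply: has_Rintegral_sum => // i.
have hRe j : has_Rintegral D (fun x => Re (G x i j)) (Re (mx_integral D G i j)).
  by split; rewrite // mxE.
have hIm j : has_Rintegral D (fun x => Im (G x i j)) (Im (mx_integral D G i j)).
  by split; rewrite // mxE.
have hentry (p q : 'I_n -> R) : has_Rintegral D
    (fun x => \sum_j (p j * Re (G x i j) + q j * Im (G x i j)))
    (\sum_j (p j * Re (mx_integral D G i j) + q j * Im (mx_integral D G i j))).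
  by apply: has_Rintegral_sum => // j; apply: has_RintegralD => //;
    exact: has_RintegralZ.
have ReE (B : 'M[R[i]]_n) : Re ((B *m z) i 0) =
    \sum_j (Re (z j 0) * Re (B i j) + - Im (z j 0) * Im (B i j)).
  by rewrite mxE Re_sumc; apply: eq_bigr => j _; rewrite Re_mulc; ring.
have ImE (B : 'M[R[i]]_n) : Im ((B *m z) i 0) =
    \sum_j (Im (z j 0) * Re (B i j) + Re (z j 0) * Im (B i j)).
  by rewrite mxE Im_sumc; apply: eq_bigr => j _; rewrite Im_mulc; ring.
apply: has_RintegralD => //; apply: has_RintegralZ => //.
- by under eq_fun do rewrite ReE; rewrite ReE; exact: hentry.
- by under eq_fun do rewrite ImE; rewrite ImE; exact: hentry.
Qed.

Lemma continuous_measurable_EFin (R : realType) (D : set R) (f : R -> R) :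
  measurable D -> continuous f -> measurable_fun D (fun x => (f x)%:E).
Proof.
move=> mD cf; apply/measurable_EFinP.
apply: (@measurable_funS _ _ _ _ setT) => //.
exact: continuous_measurable_fun.
Qed.

Lemma integrable_dominated (R : realType) (D : set R) (f g : R -> R) :
  measurable D -> continuous f ->
  (@lebesgue_measure R).-integrable D (EFin \o g) ->
  (forall x, D x -> `|f x| <= g x) ->
  (@lebesgue_measure R).-integrable D (EFin \o f).
Proof.
move=> mD cf ig fg.
apply: (@le_integrable _ _ _ (@lebesgue_measure R) D mD _ (EFin \o g)) => //.
  exact: continuous_measurable_EFin.
by move=> x Dx /=; rewrite lee_fin (le_trans (fg x Dx))// ler_norm.
Qed.

(** Duality: with y = (int G) z, the square |y|^2 is the integral of <y, G z>,
    which is at most |y| |z| times the integral of g; then divide by |y|. This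
    avoids approximating the integral by sums of matrices. *)
Lemma mx_norm2_integral_le (R : realType) (n : nat) (D : set R)
    (G : R -> 'M[R[i]]_n) (g : R -> R) (c : R) :
  measurable D ->
  (forall i j, (@lebesgue_measure R).-integrable D
                 (EFin \o (fun x => Re (G x i j)))) ->
  (forall i j, (@lebesgue_measure R).-integrable D
                 (EFin \o (fun x => Im (G x i j)))) ->
  (forall x, D x -> mx_norm2 (G x) <= g x) ->
  has_Rintegral D g c ->
  mx_norm2 (mx_integral D G) <= c.
Proof.
move=> mD iRe iIm Gg gc.
have c0 : 0 <= c.
  case: gc => _ <-; apply: Rintegral_ge0 => x Dx.
  exact: le_trans (mx_norm2_ge0 _) (Gg x Dx).
apply: mx_norm2_le => // z; set y := mx_integral D G *m z.
have [->|y0] := eqVneq y 0; first by rewrite vec_norm2_0 mulr_ge0 ?vec_norm2_ge0.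
rewrite -(ler_pM2l (vec_norm2_gt0 y0)) -expr2 vec_norm2_sqr.
rewrite [leRHS](_ : _ = vec_norm2 y * vec_norm2 z * c); last by ring.
apply: (le_has_Rintegral mD (has_Rintegral_rdot y z mD iRe iIm)
                         (has_RintegralZ _ mD gc)) => x Dx.
apply: le_trans (rdot_le _ _) _; rewrite -mulrA ler_wpM2l ?vec_norm2_ge0//.
apply: le_trans (vec_norm2_mulmx _ _) _.
by rewrite mulrC ler_wpM2l ?vec_norm2_ge0 ?Gg.
Qed.

(** * Integrals of powers along the double exponential substitution *)

Definition cosh (R : realType) (x : R) : R := (expR x + expR (- x)) / 2.

(** With t = exp (k sinh x) this is t' t^(q-1), the pullback to x of the power
    t^(q-1), and the primitive is t^q / q for q nonzero. *)
Definition de_density (R : realType) (k q x : R) : R :=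
  expR (q * (k * sinh x)) * (k * cosh x).

Lemma is_derive_sinh (R : realType) (x : R) : is_derive x 1 (@sinh R) (cosh x).
Proof.
have de : is_derive x 1 (expR \o -%R) (expR (- x) * -1).
  by apply: is_derive1_comp.
rewrite (_ : @sinh R = (2^-1 : R) *: (expR - (expR \o -%R))); last first.
  by apply/funext => y; rewrite /sinh mulrC.
apply: is_derive_eq.
by rewrite mulrN1 opprK /cosh mulrC.
Qed.

Lemma sinhN (R : realType) (x : R) : sinh (- x) = - sinh x.
Proof. by rewrite /sinh opprK -mulNr opprB. Qed.

Lemma coshN (R : realType) (x : R) : cosh (- x) = cosh x.
Proof. by rewrite /cosh opprK addrC. Qed.

Lemma cosh_gt0 (R : realType) (x : R) : 0 < cosh x.
Proof. by rewrite divr_gt0// addr_gt0// expR_gt0. Qed.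

Lemma ltr_sinh (R : realType) (x y : R) : x < y -> sinh x < sinh y.
Proof.
move=> xy; rewrite /sinh ltr_pM2r ?invr_gt0//.
by apply: ltrB; rewrite ltr_expR// ltrN2.
Qed.

Lemma continuous_sinh (R : realType) : continuous (@sinh R).
Proof.
move=> x; apply: differentiable_continuous; apply/derivable1_diffP.
by have [] := is_derive_sinh x.
Qed.

Lemma continuous_cosh (R : realType) : continuous (@cosh R).
Proof.
move=> x; apply: cvgM; last exact: cvg_cst.
apply: cvgD; first exact: continuous_expR.
by apply: (@continuous_comp _ _ _ -%R expR);
  [exact: oppr_continuous | exact: continuous_expR].
Qed.

(** From exp x >= 1 + x and exp (- x) <= 1; linear growth is all that is needed
    to see that the primitives vanish at infinity. *)
Lemma le_half_sinh (R : realType) (x : R) : 0 <= x -> x / 2 <= sinh x.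
Proof.
move=> x0; rewrite /sinh ler_pM2r ?invr_gt0//.
have e1 : expR (- x) <= 1 by rewrite expR_le1 oppr_le0.
by have := expR_ge1Dx x; lra.
Qed.

Lemma de_density_ge0 (R : realType) (k q x : R) :
  0 <= k -> 0 <= de_density k q x.
Proof.
by move=> k0; rewrite mulr_ge0 ?expR_ge0// mulr_ge0// ltW// cosh_gt0.
Qed.

Lemma continuous_de_density (R : realType) (k q : R) :
  continuous (de_density k q).
Proof.
move=> x; apply: cvgM.
  apply: (@continuous_comp _ _ _ (fun x => q * (k * sinh x)) expR).
    by do 2 (apply: cvgM; first exact: cvg_cst); exact: continuous_sinh.
  exact: continuous_expR.
by apply: cvgM; [exact: cvg_cst | exact: continuous_cosh].
Qed.

Lemma is_derive_expR_sinh (R : realType) (k q x : R) :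
  is_derive x 1 (fun y => expR (q * (k * sinh y))) (q * de_density k q x).
Proof.
have ds := is_derive_sinh x.
have dl : is_derive x 1 ((q * k) *: @sinh R) (q * k * cosh x).
  by apply: is_derive_eq.
rewrite (_ : (fun y => _) = expR \o ((q * k) *: @sinh R)); last first.
  by apply/funext => y /=; rewrite mulrA.
have de : is_derive (((q * k) *: @sinh R) x) 1 expR
    (expR (((q * k) *: @sinh R) x)) by exact: is_derive_expR.
rewrite (_ : q * de_density k q x =
             expR (((q * k) *: @sinh R) x) * (q * k * cosh x)).
  exact: is_derive1_comp.
rewrite /de_density (_ : ((q * k) *: @sinh R) x = q * (k * sinh x)).
  by ring.
by rewrite mulrA.
Qed.

Lemma expR_sinh_cvg0 (R : realType) (k p : R) : 0 < k -> 0 < p ->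
  expR (- p * (k * sinh x)) @[x --> +oo] --> 0.
Proof.
move=> k0 p0.
rewrite (_ : (fun x => _) = (fun y => expR (- y)) \o (fun x => p * (k * sinh x))).
  apply: cvg_comp (@cvgr_expR R).
  apply: (@ger_cvgy _ +oo _ _ (fun x => (p * k / 2) * x)).
    near=> x.
    have x0 : 0 <= x by near: x; exact: nbhs_pinfty_ge.
    rewrite -!mulrA ler_wpM2l ?(ltW p0)// ler_wpM2l ?(ltW k0)// mulrC.
    exact: le_half_sinh.
  by apply: gt0_cvgMry => //; rewrite ?divr_gt0 ?mulr_gt0.
by apply/funext => x /=; rewrite mulNr.
Unshelve. all: by end_near. Qed.

Lemma integral_de_density_y (R : realType) (k p r : R) : 0 < k -> 0 < p ->
  (\int[lebesgue_measure]_(x in `[r, +oo[) (de_density k (- p) x)%:E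
   = (p^-1 * expR (- p * (k * sinh r)))%:E)%E.
Proof.
move=> k0 p0.
pose F (x : R) : R := (- p^-1) * expR (- p * (k * sinh x)).
have dF (x : R) : is_derive x 1 F (de_density k (- p) x).
  have de := is_derive_expR_sinh k (- p) x.
  rewrite (_ : F = (- p^-1) *: (fun y => expR (- p * (k * sinh y))))//.
  apply: is_derive_eq.
  by rewrite /GRing.scale/= mulrA mulrNN mulVf ?mul1r// gt_eqF.
rewrite (@ge0_continuous_FTC2y _ _ F r 0).
- by rewrite /F -EFinB sub0r mulNr opprK.
- by move=> x _; exact/de_density_ge0/ltW.
- by apply: continuous_subspaceT; exact: continuous_de_density.
- rewrite -[X in _ --> X](mulr0 (- p^-1)).
  by apply: cvgM; [exact: cvg_cst | exact: expR_sinh_cvg0].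
- by move=> x _; have [] := dF x.
- apply: cvg_at_right_filter.
  apply: differentiable_continuous; apply/derivable1_diffP.
  by have [] := dF r.
- by move=> x _; rewrite derive1E derive_val.
Qed.

Lemma has_Rintegral_ge0 (R : realType) (D : set R) (f : R -> R) (v : R) :
  measurable D -> continuous f -> (forall x, 0 <= f x) ->
  (\int[lebesgue_measure]_(x in D) (f x)%:E = v%:E)%E ->
  has_Rintegral D f v.
Proof.
move=> mD cf f0 fv; split; last by rewrite /Rintegral fv.
apply/integrableP; split.
  exact: continuous_measurable_EFin.
apply: (@le_lt_trans _ _ v%:E); last exact: ltry.
rewrite -fv le_eqVlt; apply/orP; left; apply/eqP; apply: eq_integral => x _.
by rewrite /= ger0_norm.
Qed.

Lemma has_Rintegral_de_density_right (R : realType) (k p r : R) :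
  0 < k -> 0 < p ->
  has_Rintegral `]r, +oo[ (de_density k (- p)) (p^-1 * expR (- p * (k * sinh r))).
Proof.
move=> k0 p0; apply: has_Rintegral_ge0 => //.
- exact: continuous_de_density.
- by move=> x; exact/de_density_ge0/ltW.
rewrite integral_itv_obnd_cbnd; last first.
  by apply: continuous_measurable_EFin => //; exact: continuous_de_density.
exact: integral_de_density_y.
Qed.

(** Reflection x |-> - x turns this tail into a right one, since sinh is odd and
    cosh is even. *)
Lemma has_Rintegral_de_density_left (R : realType) (k p l : R) :
  0 < k -> 0 < p ->
  has_Rintegral `]-oo, l[ (de_density k p) (p^-1 * expR (p * (k * sinh l))).
Proof.
move=> k0 p0; apply: has_Rintegral_ge0 => //.
- exact: continuous_de_density.
- by move=> x; exact/de_density_ge0/ltW.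
rewrite integral_itv_bndo_bndc; last first.
  by apply: continuous_measurable_EFin => //; exact: continuous_de_density.
rewrite -[l in `]-oo, l]]opprK ge0_integration_by_substitutionNy.
- rewrite (_ : p * (k * sinh l) = - p * (k * sinh (- l))); last first.
    by rewrite sinhN; ring.
  rewrite -integral_de_density_y//; apply: eq_integral => x _.
  by rewrite /= /de_density sinhN coshN !mulrN mulNr.
- by apply: continuous_subspaceT; exact: continuous_de_density.
- by move=> x _; exact/de_density_ge0/ltW.
Qed.

(** * Continuity of complex-valued functions and of matrix inverses *)

(** Continuity is asked of the two real components because these are the
    functions that the entrywise integral integrates. *)
Definition ccontinuous (R : realType) (f : R -> R[i]) :=
  continuous (fun x => Re (f x)) /\ continuous (fun x => Im (f x)).

Lemma ccontinuous_cst (R : realType) (c : R[i]) : ccontinuous (fun _ : R => c).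
Proof. by split => x; exact: cvg_cst. Qed.

Lemma ccontinuous_real (R : realType) (f : R -> R) :
  continuous f -> ccontinuous (fun x => (f x)%:C).
Proof. by move=> cf; split => //= x; exact: cvg_cst. Qed.

Lemma ccontinuousD (R : realType) (f g : R -> R[i]) :
  ccontinuous f -> ccontinuous g -> ccontinuous (fun x => f x + g x).
Proof.
move=> [fr fi] [gr gi]; split => x.
- by under eq_fun do rewrite Re_addc; apply: cvgD; [exact: fr | exact: gr].
- by under eq_fun do rewrite Im_addc; apply: cvgD; [exact: fi | exact: gi].
Qed.

Lemma ccontinuousM (R : realType) (f g : R -> R[i]) :
  ccontinuous f -> ccontinuous g -> ccontinuous (fun x => f x * g x).
Proof.
move=> [fr fi] [gr gi]; split => x.
- under eq_fun do rewrite Re_mulc.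
  by apply: cvgB; apply: cvgM; [exact: fr | exact: gr | exact: fi | exact: gi].
- under eq_fun do rewrite Im_mulc.
  by apply: cvgD; apply: cvgM; [exact: fr | exact: gi | exact: fi | exact: gr].
Qed.

Lemma ccontinuousV (R : realType) (f : R -> R[i]) :
  (forall x, f x != 0) -> ccontinuous f -> ccontinuous (fun x => (f x)^-1).
Proof.
move=> f0 [fr fi].
pose q x := Re (f x) ^+ 2 + Im (f x) ^+ 2.
have q0 x : q x != 0.
  rewrite paddr_eq0 ?sqr_ge0// !sqrf_eq0.
  by move: (f0 x); rewrite eq_complex.
have cq : continuous (fun x => (q x)^-1).
  move=> x; apply: cvgV; first exact: q0.
  by apply: cvgD; rewrite /=; under eq_fun do rewrite expr2; apply: cvgM;
    (exact: fr || exact: fi).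
split => x.
- rewrite (_ : (fun x => _) = fun x => Re (f x) * (q x)^-1); last first.
    by apply/funext => z; rewrite /q; case: (f z).
  by apply: cvgM; [exact: fr | exact: cq].
- rewrite (_ : (fun x => _) = fun x => - (Im (f x) * (q x)^-1)); last first.
    by apply/funext => z; rewrite /q; case: (f z).
  by apply: cvgN; apply: cvgM; [exact: fi | exact: cq].
Qed.

Lemma ccontinuous_sum (R : realType) (I : Type) (s : seq I) (P : pred I)
    (f : I -> R -> R[i]) :
  (forall i, ccontinuous (f i)) ->
  ccontinuous (fun x => \sum_(i <- s | P i) f i x).
Proof.
move=> cf; elim: s => [|i s ih].
  by under eq_fun do rewrite big_nil; exact: ccontinuous_cst.
case Pi: (P i); under eq_fun do rewrite big_cons Pi; last exact: ih.
exact: ccontinuousD.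
Qed.

Lemma ccontinuous_prod (R : realType) (I : Type) (s : seq I) (P : pred I)
    (f : I -> R -> R[i]) :
  (forall i, ccontinuous (f i)) ->
  ccontinuous (fun x => \prod_(i <- s | P i) f i x).
Proof.
move=> cf; elim: s => [|i s ih].
  by under eq_fun do rewrite big_nil; exact: ccontinuous_cst.
case Pi: (P i); under eq_fun do rewrite big_cons Pi; last exact: ih.
exact: ccontinuousM.
Qed.

Lemma ccontinuous_det (R : realType) (n : nat) (B : R -> 'M[R[i]]_n) :
  (forall i j, ccontinuous (fun x => B x i j)) ->
  ccontinuous (fun x => \det (B x)).
Proof.
move=> cB; apply: ccontinuous_sum => s; apply: ccontinuousM.
  exact: ccontinuous_cst.
by apply: ccontinuous_prod => k; exact: cB.
Qed.

Lemma ccontinuous_mulmx (R : realType) (m n p : nat)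
    (B : R -> 'M[R[i]]_(m, n)) (C : R -> 'M[R[i]]_(n, p)) :
  (forall i j, ccontinuous (fun x => B x i j)) ->
  (forall i j, ccontinuous (fun x => C x i j)) ->
  forall i j, ccontinuous (fun x => (B x *m C x) i j).
Proof.
move=> cB cC i j; under eq_fun do rewrite mxE.
by apply: ccontinuous_sum => k; exact: ccontinuousM.
Qed.

(** Cramer's rule writes the entries of the inverse as quotients of
    determinants. *)
Lemma ccontinuous_invmx (R : realType) (n : nat) (B : R -> 'M[R[i]]_n) :
  (forall x, B x \in unitmx) ->
  (forall i j, ccontinuous (fun x => B x i j)) ->
  forall i j, ccontinuous (fun x => invmx (B x) i j).
Proof.
move=> uB cB i j.
rewrite (_ : (fun x => _) = fun x => (\det (B x))^-1 * cofactor (B x) j i).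
  apply: ccontinuousM.
    apply: ccontinuousV; last exact: ccontinuous_det.
    by move=> x; rewrite -unitfE -unitmxE.
  apply: ccontinuousM; first exact: ccontinuous_cst.
  by apply: ccontinuous_det => k l; under eq_fun do rewrite !mxE; exact: cB.
by apply/funext => x; rewrite /invmx uB !mxE.
Qed.

(** * Resolvent bounds *)

(** A singular s I + A would have the nonpositive eigenvalue - s. *)
Lemma shift_unitmx (R : realType) (n : nat) (A : 'M[R[i]]_n) (s : R) :
  (forall x : R, x <= 0 -> ~~ eigenvalue A x%:C) -> 0 <= s ->
  s%:C%:M + A \in unitmx.
Proof.
move=> hA s0; have := hA (- s); rewrite oppr_le0 => /(_ s0).
rewrite /eigenvalue /eigenspace negbK kermx_eq0 row_free_unit.
by rewrite rmorphN raddfN opprK addrC.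
Qed.

Lemma unitmx_of_eigenvalue (R : realType) (n : nat) (A : 'M[R[i]]_n) :
  (forall x : R, x <= 0 -> ~~ eigenvalue A x%:C) -> A \in unitmx.
Proof.
by move=> hA; rewrite -[A]add0r -(raddf0 (@scalar_mx _ n)) shift_unitmx.
Qed.

(** The hypothesis says (1 - q) v <= u, and (1 + 2 q) (1 - q) >= 1 for q in
    [0, 1/2]; this linearizes the geometric series 1 / (1 - q). *)
Lemma le_absorb (R : realFieldType) (q u v : R) :
  0 <= q -> q <= 1 / 2 -> 0 <= v -> v <= u + q * v -> v <= (1 + 2 * q) * u.
Proof.
move=> q0 q12 v0 vq.
have h1 : 0 <= (1 + 2 * q) * (u + q * v - v) by apply: mulr_ge0; lra.
have h2 : 0 <= q * (1 - 2 * q) * v by rewrite !mulr_ge0//; lra.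
by nra.
Qed.

Lemma resolvent_shiftE (R : realType) (n : nat) (A : 'M[R[i]]_n) (s : R)
    (x : 'cV[R[i]]_n) :
  s%:C%:M + A \in unitmx ->
  x = s%:C *: (invmx (s%:C%:M + A) *m x)
      + A *m invmx (s%:C%:M + A) *m x.
Proof.
move=> uB; rewrite -[LHS]mul1mx -(mulmxV uB) mulmxDl mulmxDl.
by rewrite mul_scalar_mx scalemxAl.
Qed.

(** With z = A (s I + A)^-1 x one has x = s A^-1 z + z, so that |z| is at most
    |x| + s |A^-1| |z|, where the last term is at most |z| / 2. *)
Lemma resolvent_norm_small (R : realType) (n : nat) (A : 'M[R[i]]_n) (s : R) :
  A \in unitmx -> s%:C%:M + A \in unitmx -> 0 <= s ->
  s * mx_norm2 (invmx A) <= 1 / 2 ->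
  mx_norm2 (A *m invmx (s%:C%:M + A)) <= 1 + 2 * (s * mx_norm2 (invmx A)).
Proof.
move=> uA uB s0; set q := s * _ => q12.
have q0 : 0 <= q by rewrite mulr_ge0 ?mx_norm2_ge0.
apply: mx_norm2_le => [|x]; first by lra.
set z := A *m _ *m x.
have zE : z = x + (- s)%:C *: (invmx A *m z).
  rewrite {1}(resolvent_shiftE x uB) -/z mulmxA mulmxA mulVmx// mul1mx.
  by rewrite rmorphN scaleNr addrAC subrr add0r.
have zq : vec_norm2 z <= vec_norm2 x + q * vec_norm2 z.
  rewrite {1}zE; apply: le_trans (vec_norm2D _ _) _.
  rewrite lerD2l vec_norm2Z normrN ger0_norm// -mulrA ler_wpM2l//.
  exact: vec_norm2_mulmx.
exact/(le_absorb q0 q12 _ zq)/vec_norm2_ge0.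
Qed.

(** With y = (s I + A)^-1 x one has x = s y + A y, so that (s - |A|) |y| is at
    most |x|. *)
Lemma resolvent_norm_large (R : realType) (n : nat) (A : 'M[R[i]]_n) (s : R) :
  s%:C%:M + A \in unitmx -> 0 < s ->
  mx_norm2 A / s <= 1 / 2 ->
  mx_norm2 (A *m invmx (s%:C%:M + A))
    <= mx_norm2 A / s * (1 + 2 * (mx_norm2 A / s)).
Proof.
move=> uB s0; set N := mx_norm2 A; set q := N / s => q12.
have N0 : 0 <= N by exact: mx_norm2_ge0.
have q0 : 0 <= q by rewrite divr_ge0// ltW.
have NE : N = q * s by rewrite /q mulfVK// gt_eqF.
clearbody q.
apply: mx_norm2_le => [|x]; first by nra.
set y := invmx (s%:C%:M + A) *m x.
have sy : s * vec_norm2 y <= vec_norm2 x + N * vec_norm2 y.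
  have -> : s * vec_norm2 y = vec_norm2 (x + (- 1)%:C *: (A *m y)).
    rewrite [in RHS](resolvent_shiftE x uB) -/y -mulmxA -/y rmorphN scaleNr.
    by rewrite rmorph1 scale1r addrK vec_norm2Z gtr0_norm.
  apply: le_trans (vec_norm2D _ _) _.
  by rewrite vec_norm2Z normrN1 mul1r lerD2l vec_norm2_mulmx.
rewrite -mulmxA -/y; apply: le_trans (vec_norm2_mulmx _ _) _; rewrite -/N.
rewrite {1}NE -!mulrA ler_wpM2l//; apply: le_absorb => //.
  by rewrite mulr_ge0 ?vec_norm2_ge0// ltW.
by rewrite [q * _]mulrA -NE.
Qed.

(** * The double exponential integrand *)

(** For t = exp (k sinh x) with k = alpha pi / 2, the power t^(1/alpha) is
    exp ((1/alpha) k sinh x). *)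
Lemma F_DE_E (R : realType) (n : nat) (A : 'M[R[i]]_n) (alpha x : R) :
  F_DE A alpha x =
  (sin (alpha * pi) / (alpha * pi) * de_density (alpha * pi / 2) 1 x)%:C *:
    (A *m invmx ((expR (alpha^-1 * (alpha * pi / 2 * sinh x)))%:C%:M + A)).
Proof.
have tE : t_DE alpha = fun x => expR (1 * (alpha * pi / 2 * sinh x)).
  by apply/funext => y; rewrite /t_DE mul1r mulrAC.
have dt := is_derive_expR_sinh (alpha * pi / 2) 1 x.
rewrite /F_DE /F_int tE derive1E derive_val mul1r -expRM mul1r mulrC.
by rewrite scalerA -rmorphM /= mulrC [_ * alpha^-1]mulrC.
Qed.

Lemma ccontinuous_F_DE (R : realType) (n : nat) (A : 'M[R[i]]_n) (alpha : R) :
  (forall x : R, x <= 0 -> ~~ eigenvalue A x%:C) ->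
  forall i j, ccontinuous (fun x => F_DE A alpha x i j).
Proof.
move=> hA i j; under eq_fun do rewrite F_DE_E mxE.
apply: ccontinuousM.
  apply: ccontinuous_real => x; apply: cvgM; first exact: cvg_cst.
  exact: continuous_de_density.
apply: ccontinuous_mulmx => k l; first exact: ccontinuous_cst.
apply: ccontinuous_invmx => [x|k' l'].
  by apply: shift_unitmx => //; exact: expR_ge0.
under eq_fun do rewrite mxE; apply: ccontinuousD; last exact: ccontinuous_cst.
under eq_fun do rewrite mxE -[_ *+ (k' == l')]mulr_natr; apply: ccontinuousM; last first.
  exact: ccontinuous_cst.
apply: ccontinuous_real => x.
apply: (@continuous_comp _ _ _ (fun x => alpha^-1 * (alpha * pi / 2 * sinh x)) expR).
  by do 2 (apply: cvgM; first exact: cvg_cst); exact: continuous_sinh.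
exact: continuous_expR.
Qed.

Lemma de_densityM (R : realType) (k p q x : R) :
  de_density k p x * expR (q * (k * sinh x)) = de_density k (p + q) x.
Proof. by rewrite /de_density mulrDl expRD; ring. Qed.

(** The bound c (1 + 2 s M) t' with s = t^(1/alpha), written as a combination of
    t' and t' t^(1/alpha). *)
Lemma F_DE_left_le (R : realType) (n : nat) (A : 'M[R[i]]_n) (alpha l x : R)
    (M := mx_norm2 (invmx A)) (k := alpha * pi / 2)
    (c := sin (alpha * pi) / (alpha * pi)) :
  (forall x : R, x <= 0 -> ~~ eigenvalue A x%:C) ->
  0 < alpha -> 0 < k -> 0 <= c ->
  expR (alpha^-1 * (k * sinh l)) * M <= 1 / 2 -> x < l ->
  mx_norm2 (F_DE A alpha x) <=
  c * de_density k 1 x + 2 * c * M * de_density k (1 + alpha^-1) x.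
Proof.
move=> hA a0 k0 c0 lM xl; rewrite F_DE_E -/k -/c.
have d0 : 0 <= c * de_density k 1 x by rewrite mulr_ge0// de_density_ge0// ltW.
apply: le_trans (mx_norm2Z_le _ d0) _.
rewrite -de_densityM; set s := expR (alpha^-1 * (k * sinh x)).
have s0 : 0 <= s by exact: expR_ge0.
have uA := unitmx_of_eigenvalue hA.
rewrite [leRHS](_ : _ = c * de_density k 1 x * (1 + 2 * (s * M))); last by ring.
rewrite ler_wpM2l// resolvent_norm_small ?shift_unitmx// -/M.
apply: le_trans lM; rewrite ler_wpM2r ?mx_norm2_ge0//.
by rewrite ler_expR ler_pM2l ?invr_gt0// ler_pM2l// ltW// ltr_sinh.
Qed.

(** The bound c (N / s) (1 + 2 N / s) t' with s = t^(1/alpha), written as a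
    combination of t' t^(-1/alpha) and t' t^(-2/alpha). *)
Lemma F_DE_right_le (R : realType) (n : nat) (A : 'M[R[i]]_n) (alpha r x : R)
    (N := mx_norm2 A) (k := alpha * pi / 2)
    (c := sin (alpha * pi) / (alpha * pi)) :
  (forall x : R, x <= 0 -> ~~ eigenvalue A x%:C) ->
  0 < alpha -> 0 < k -> 0 <= c ->
  N * expR (- (alpha^-1 * (k * sinh r))) <= 1 / 2 -> r < x ->
  mx_norm2 (F_DE A alpha x) <=
  c * N * de_density k (- (alpha^-1 - 1)) x
  + 2 * c * N ^+ 2 * de_density k (- (2 * alpha^-1 - 1)) x.
Proof.
move=> hA a0 k0 c0 rN rx; rewrite F_DE_E -/k -/c.
have d0 : 0 <= c * de_density k 1 x by rewrite mulr_ge0// de_density_ge0// ltW.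
apply: le_trans (mx_norm2Z_le _ d0) _.
set s := expR (alpha^-1 * (k * sinh x)).
have s0 : 0 < s by exact: expR_gt0.
have sV : expR (- alpha^-1 * (k * sinh x)) = s^-1 by rewrite mulNr expRN.
rewrite (_ : - (alpha^-1 - 1) = 1 + - alpha^-1); last by ring.
rewrite (_ : - (2 * alpha^-1 - 1) = 1 + - alpha^-1 + - alpha^-1); last by ring.
rewrite -!de_densityM sV.
rewrite [leRHS](_ : _ = c * de_density k 1 x * (N / s * (1 + 2 * (N / s)))).
  rewrite ler_wpM2l// resolvent_norm_large ?shift_unitmx ?(ltW s0)// -/N.
  apply: le_trans rN; rewrite ler_wpM2l ?mx_norm2_ge0// -expRN.
  by rewrite ler_expR lerN2 ler_pM2l ?invr_gt0// ler_pM2l// ltW// ltr_sinh.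
by ring.
Qed.

(** * Splitting off the tails *)

Lemma has_Rintegral_setU (R : realType) (A B : set R) (f : R -> R) (u v : R) :
  measurable A -> measurable B -> [disjoint A & B] ->
  has_Rintegral A f u -> has_Rintegral B f v ->
  has_Rintegral (A `|` B) f (u + v).
Proof.
move=> mA mB AB [fA <-] [fB <-].
suff fAB : (@lebesgue_measure R).-integrable (A `|` B) (EFin \o f).
  by split=> //; rewrite Rintegral_setU.
move: fA fB => /integrableP[mfA fA] /integrableP[mfB fB].
have mfAB : measurable_fun (A `|` B) (EFin \o f) by exact/measurable_funU.
apply/integrableP; split => //.
rewrite ge0_integral_setU//; first exact: lte_add_pinfty.
exact: measurableT_comp.
Qed.

Lemma has_Rintegral_split (R : realType) (l r : R) (f : R -> R) (u v : R) :
  l <= r -> continuous f ->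
  has_Rintegral `]-oo, l[ f u -> has_Rintegral `]r, +oo[ f v ->
  \int[lebesgue_measure]_(x in [set: R]) f x
  - \int[lebesgue_measure]_(x in `[l, r]) f x = u + v.
Proof.
move=> lr cf fl fr.
have fm : has_Rintegral `[l, r] f (\int[lebesgue_measure]_(x in `[l, r]) f x).
  split=> //; apply: continuous_compact_integrable; first exact: segment_compact.
  exact: continuous_subspaceT.
have -> : [set: R] = `]-oo, l[ `|` (`[l, r] `|` `]r, +oo[).
  rewrite -itv_bndbnd_setU ?bnd_simp// -itv_bndbnd_setU ?bnd_simp//.
  by rewrite set_itvNyy.
have fmr : has_Rintegral (`[l, r] `|` `]r, +oo[) f
    (\int[lebesgue_measure]_(x in `[l, r]) f x + v).
  apply: has_Rintegral_setU => //; apply/disj_setPS => x [/=].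
  by rewrite !in_itv/= => /andP[_ xr]; rewrite andbT ltNge xr.
have mmr : measurable (`[l, r] `|` `]r, +oo[).
  by apply: measurableU; exact: measurable_itv.
have dl : [disjoint `]-oo, l[ & `[l, r] `|` `]r, +oo[].
  rewrite -itv_bndbnd_setU ?bnd_simp//; apply/disj_setPS => x [/=].
  by rewrite !in_itv/= andbT ltNge => /negbTE ->.
have [_ ->] := has_Rintegral_setU (measurable_itv _) mmr dl fl fmr.
by ring.
Qed.

(** The majorants serve twice: they make the entries integrable on the tails,
    so that the integral over the line is the sum of three, and they bound the
    two tails that remain. *)
Lemma mx_integral_split (R : realType) (n : nat) (l r : R)
    (G : R -> 'M[R[i]]_n) (gl gr : R -> R) (vl vr : R) :
  l <= r -> (forall i j, ccontinuous (fun x => G x i j)) ->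
  has_Rintegral `]-oo, l[ gl vl -> has_Rintegral `]r, +oo[ gr vr ->
  (forall x, x < l -> mx_norm2 (G x) <= gl x) ->
  (forall x, r < x -> mx_norm2 (G x) <= gr x) ->
  mx_norm2 (mx_integral [set: R] G - mx_integral `[l, r] G) <= vl + vr.
Proof.
move=> lr cG il ir Gl Gr.
have Gl' x : `]-oo, l[%classic x -> mx_norm2 (G x) <= gl x.
  by rewrite /= in_itv/=; exact: Gl.
have Gr' x : `]r, +oo[%classic x -> mx_norm2 (G x) <= gr x.
  by rewrite /= in_itv/= andbT; exact: Gr.
have Rel i j : (@lebesgue_measure R).-integrable `]-oo, l[
    (EFin \o (fun x => Re (G x i j))).
  apply: (integrable_dominated _ (cG i j).1 il.1) => // x /Gl'.
  exact/le_trans/normr_Re_le.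
have Iml i j : (@lebesgue_measure R).-integrable `]-oo, l[
    (EFin \o (fun x => Im (G x i j))).
  apply: (integrable_dominated _ (cG i j).2 il.1) => // x /Gl'.
  exact/le_trans/normr_Im_le.
have Rer i j : (@lebesgue_measure R).-integrable `]r, +oo[
    (EFin \o (fun x => Re (G x i j))).
  apply: (integrable_dominated _ (cG i j).1 ir.1) => // x /Gr'.
  exact/le_trans/normr_Re_le.
have Imr i j : (@lebesgue_measure R).-integrable `]r, +oo[
    (EFin \o (fun x => Im (G x i j))).
  apply: (integrable_dominated _ (cG i j).2 ir.1) => // x /Gr'.
  exact/le_trans/normr_Im_le.
have -> : mx_integral [set: R] G - mx_integral `[l, r] G =
    mx_integral `]-oo, l[ G + mx_integral `]r, +oo[ G.
  apply/matrixP => i j; rewrite !mxE; apply/eqP; rewrite eq_complex.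
  apply/andP; split; apply/eqP => /=;
    (apply: has_Rintegral_split; [exact: lr | | by split..]).
  - exact: (cG i j).1.
  - exact: (cG i j).2.
apply: le_trans (mx_norm2D _ _) _; apply: lerD.
- exact: mx_norm2_integral_le Gl' il.
- exact: mx_norm2_integral_le Gr' ir.
Qed.

(** * Scalar estimates at the end points *)

(** The left-hand side is the integral of c (1 + 2 t^(1/al) M) over (0, a); here
    u stands for a^(1/al), S for sin (al pi) and p for pi. Replacing 2 u M by 1
    leaves K a, where K is the reciprocal of the factor of eps / 4 in the bound
    on a. *)
Lemma left_tail_bound (R : realType) (p S al a u M eps : R) :
  0 < p -> 0 < S -> 0 < al -> 0 < a -> u * M <= 1 / 2 ->
  a <= eps / 4 * (p * al * (1 + al) / (S * (1 + 2 * al))) ->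
  S / (al * p) * (1^-1 * a)
  + 2 * (S / (al * p)) * M * ((1 + al^-1)^-1 * (a * u)) <= eps / 4.
Proof.
move=> p0 S0 al0 a0 uM aE.
have al1 : 0 < 1 + al by lra.
have al2 : 0 < 1 + 2 * al by lra.
pose K := S * (1 + 2 * al) / (p * al * (1 + al)).
have K0 : 0 < K by rewrite /K divr_gt0 ?mulr_gt0.
apply: (@le_trans _ _ (K * a)); last first.
  rewrite mulrC -ler_pdivlMr//; apply: le_trans aE _.
  by rewrite /K invf_div.
have -> : S / (al * p) * (1^-1 * a)
    + 2 * (S / (al * p)) * M * ((1 + al^-1)^-1 * (a * u)) =
    S / (al * p) * a * (1 + al / (1 + al) * (2 * (u * M))).
  by field; rewrite ?gt_eqF.
have -> : K * a = S / (al * p) * a * (1 + al / (1 + al) * 1).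
  by rewrite /K; field; rewrite ?gt_eqF.
apply: ler_wpM2l; first by apply: ltW; rewrite !(mulr_gt0, invr_gt0).
rewrite lerD2l; apply: ler_wpM2l; last by lra.
by apply: ltW; rewrite divr_gt0.
Qed.

(** The left-hand side is the integral of c (N / s) (1 + 2 N / s) over (b, oo),
    with s = t^(1/al), e = b^((al-1)/al), w = b^(-1/al), and again S for
    sin (al pi) and p for pi. Replacing 2 N w by 1 leaves K e. *)
Lemma right_tail_bound (R : realType) (p S al e w N eps : R) :
  0 < p -> 0 < S -> 0 < al -> al < 1 -> 0 <= e -> 0 < N -> N * w <= 1 / 2 ->
  e <= eps / 4 * (p * (1 - al) * (2 - al) / (S * (3 - 2 * al) * N)) ->
  S / (al * p) * N * ((al^-1 - 1)^-1 * e)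
  + 2 * (S / (al * p)) * N ^+ 2 * ((2 * al^-1 - 1)^-1 * (e * w)) <= eps / 4.
Proof.
move=> p0 S0 al0 al1 e0 N0 Nw eE.
have b1 : 0 < 1 - al by lra.
have b2 : 0 < 2 - al by lra.
have b3 : 0 < 3 - 2 * al by lra.
pose K := S * (3 - 2 * al) * N / (p * (1 - al) * (2 - al)).
have K0 : 0 < K by rewrite /K divr_gt0 ?mulr_gt0.
apply: (@le_trans _ _ (K * e)); last first.
  rewrite mulrC -ler_pdivlMr//; apply: le_trans eE _.
  by rewrite /K invf_div.
have -> : S / (al * p) * N * ((al^-1 - 1)^-1 * e)
    + 2 * (S / (al * p)) * N ^+ 2 * ((2 * al^-1 - 1)^-1 * (e * w)) =
    S * N * e / p * ((1 - al)^-1 + (2 - al)^-1 * (2 * (N * w))).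
  by field; rewrite ?gt_eqF.
have -> : K * e = S * N * e / p * ((1 - al)^-1 + (2 - al)^-1 * 1).
  by rewrite /K; field; rewrite ?gt_eqF.
apply: ler_wpM2l.
  by rewrite mulr_ge0 ?invr_ge0 ?(ltW p0)// mulr_ge0// ltW// mulr_gt0.
rewrite lerD2l; apply: ler_wpM2l; last by lra.
by rewrite invr_ge0 ltW.
Qed.

(** Gives s M <= 1/2 on the whole left tail, where s = t^(1/al) <= a^(1/al). *)
Lemma left_endpoint_le (R : realType) (al a M : R) :
  0 < al -> 0 < M -> 0 < a -> a <= (2 * M) `^ (- al) ->
  expR (al^-1 * ln a) * M <= 1 / 2.
Proof.
move=> al0 M0 a0 aM; have MM0 : 0 < 2 * M by rewrite mulr_gt0.
rewrite -ler_pdivlMr// -mulrA mul1r -invfM -[leRHS]lnK ?posrE ?invr_gt0//.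
rewrite ler_expR lnV ?posrE// ler_pdivrMl// mulrN -mulNr.
by rewrite -ln_powR ler_ln ?posrE ?powR_gt0.
Qed.

(** Gives N / s <= 1/2 on the whole right tail, where s = t^(1/al) >= b^(1/al). *)
Lemma right_endpoint_le (R : realType) (al b N : R) :
  0 < al -> 0 < N -> (2 * N) `^ al <= b ->
  N * expR (- (al^-1 * ln b)) <= 1 / 2.
Proof.
move=> al0 N0 bN; have NN0 : 0 < 2 * N by rewrite mulr_gt0.
have b0 : 0 < b by apply: lt_le_trans bN; exact: powR_gt0.
rewrite mulrC -ler_pdivlMr// -mulrA mul1r -invfM.
rewrite -[leRHS]lnK ?posrE ?invr_gt0//.
rewrite ler_expR lnV ?posrE// lerN2 ler_pdivlMl//.
by rewrite -ln_powR ler_ln ?posrE ?powR_gt0.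
Qed.

(** Since 1 / M <= N, the bound (2 M)^(- al) is at most (2 N)^al. *)
Lemma endpoints_le (R : realType) (al a b M N : R) :
  0 < al -> 0 < M -> 0 < N -> 1 <= N * M -> 0 < a ->
  a <= (2 * M) `^ (- al) -> (2 * N) `^ al <= b -> a <= b.
Proof.
move=> al0 M0 N0 NM a0 aM bN; apply: le_trans aM (le_trans _ bN).
have NN0 : 0 < 2 * N by rewrite mulr_gt0.
have MM0 : 0 < 2 * M by rewrite mulr_gt0.
rewrite powRN -[leLHS]mul1r ler_pdivrMr ?powR_gt0//.
rewrite -(powRM _ (ltW NN0) (ltW MM0)).
rewrite [leLHS](_ : 1 = 1 `^ al); last by rewrite powR1.
apply: ge0_ler_powR; rewrite ?nnegrE ?(ltW al0)//.
  by rewrite mulr_ge0 ?(ltW NN0) ?(ltW MM0).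
by clear -NM; lra.
Qed.

(** The exponent al / (al - 1) is inverse to (al - 1) / al and negative: a lower
    bound on b bounds b^((al-1)/al) from above. *)
Lemma right_endpoint_decay (R : realType) (al b Q : R) :
  0 < al -> al < 1 -> 0 < Q -> Q `^ (al / (al - 1)) <= b ->
  expR (- (al^-1 - 1) * ln b) <= Q.
Proof.
move=> al0 al1 Q0 bQ.
have b0 : 0 < b by apply: lt_le_trans bQ; exact: powR_gt0.
have p1 : 0 < al^-1 - 1 by rewrite subr_gt0 invf_gt1.
rewrite -[leRHS]lnK ?posrE// ler_expR mulNr lerNl.
apply: (@le_trans _ _ ((al^-1 - 1) * (al / (al - 1) * ln Q))).
  rewrite le_eqVlt; apply/orP; left; apply/eqP; field.
  by rewrite subr_eq0 (lt_eqF al1) gt_eqF.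
by rewrite ler_pM2l// -ln_powR ler_ln ?posrE ?powR_gt0.
Qed.

(** * The truncation error *)

Lemma has_Rintegral_left_majorant (R : realType) (k c M al a l : R) :
  0 < k -> 0 < al -> 0 < a -> k * sinh l = ln a ->
  has_Rintegral `]-oo, l[
    (fun x => c * de_density k 1 x + 2 * c * M * de_density k (1 + al^-1) x)
    (c * (1^-1 * a) + 2 * c * M * ((1 + al^-1)^-1 * (a * expR (al^-1 * ln a)))).
Proof.
move=> k0 al0 a0 kl.
have aE : a = expR (1 * (k * sinh l)) by rewrite mul1r kl lnK.
have auE : a * expR (al^-1 * ln a) = expR ((1 + al^-1) * (k * sinh l)).
  by rewrite kl mulrDl expRD mul1r lnK.
rewrite auE {1}aE.
have q0 : 0 < 1 + al^-1 by rewrite addr_gt0 ?invr_gt0.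
by apply: has_RintegralD => //; apply: has_RintegralZ => //;
  exact: has_Rintegral_de_density_left.
Qed.

Lemma has_Rintegral_right_majorant (R : realType) (k c N al b r : R)
    (e := expR (- (al^-1 - 1) * ln b)) :
  0 < k -> 0 < al -> al < 1 -> k * sinh r = ln b ->
  has_Rintegral `]r, +oo[
    (fun x => c * N * de_density k (- (al^-1 - 1)) x
              + 2 * c * N ^+ 2 * de_density k (- (2 * al^-1 - 1)) x)
    (c * N * ((al^-1 - 1)^-1 * e)
     + 2 * c * N ^+ 2 * ((2 * al^-1 - 1)^-1 * (e * expR (- (al^-1 * ln b))))).
Proof.
move=> k0 al0 al1 kr.
have p1 : 0 < al^-1 - 1 by rewrite subr_gt0 invf_gt1.
have p2 : 0 < 2 * al^-1 - 1 by lra.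
have ewE : e * expR (- (al^-1 * ln b)) =
    expR (- (2 * al^-1 - 1) * (k * sinh r)).
  by rewrite kr /e -expRD; congr expR; ring.
rewrite ewE /e -{1}kr.
by apply: has_RintegralD => //; apply: has_RintegralZ => //;
  exact: has_Rintegral_de_density_right.
Qed.

(** The two end points are only constrained by inequalities, so the estimate
    holds for every a small enough and every b large enough. *)
Lemma truncation_error_le (R : realType) (n : nat) (A : 'M[R[i]]_n)
    (alpha eps a b l r : R) (M := mx_norm2 (invmx A)) (N := mx_norm2 A)
    (S := sin (alpha * pi)) :
  (0 < n)%N -> (forall x : R, x <= 0 -> ~~ eigenvalue A x%:C) ->
  0 < alpha -> alpha < 1 -> 0 < eps -> 0 < a ->
  a <= eps / 4 * (pi * alpha * (1 + alpha) / (S * (1 + 2 * alpha))) ->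
  a <= (2 * M) `^ (- alpha) ->
  (eps / 4 * (pi * (1 - alpha) * (2 - alpha) / (S * (3 - 2 * alpha) * N)))
     `^ (alpha / (alpha - 1)) <= b ->
  (2 * N) `^ alpha <= b ->
  alpha * pi / 2 * sinh l = ln a -> alpha * pi / 2 * sinh r = ln b ->
  mx_norm2 (mx_integral [set: R] (F_DE A alpha)
            - mx_integral `[l, r] (F_DE A alpha)) <= eps / 2.
Proof.
move=> n0 hA al0 al1 eps0 a0 aP aM bQ bN kl kr.
have d1 : 0 < 1 - alpha by rewrite subr_gt0.
have d2 : 0 < 2 - alpha by rewrite subr_gt0 (lt_trans al1) ?ltr1n.
have d3 : 0 < 3 - 2 * alpha by clear -al1; lra.
have pi0 : 0 < (pi : R) by exact: pi_gt0.
have ap0 : 0 < alpha * pi by rewrite mulr_gt0.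
have S0 : 0 < S by apply: sin_gt0_pi; rewrite ap0 gtr_pMl.
have k0 : 0 < alpha * pi / 2 by rewrite divr_gt0.
have c0 : 0 <= S / (alpha * pi) by apply: ltW; rewrite divr_gt0.
have uA := unitmx_of_eigenvalue hA.
have NM1 : 1 <= N * M by exact: mx_norm2_invmx_ge1.
have N0 : 0 < N by exact: mx_norm2_gt0.
have M0 : 0 < M by rewrite mx_norm2_gt0// unitmx_inv.
have Q0 : 0 < eps / 4 * (pi * (1 - alpha) * (2 - alpha)
                         / (S * (3 - 2 * alpha) * N)).
  apply: mulr_gt0; first exact: divr_gt0.
  apply: divr_gt0; first exact: mulr_gt0 (mulr_gt0 pi0 d1) d2.
  exact: mulr_gt0 (mulr_gt0 S0 d3) N0.
have ab := endpoints_le al0 M0 N0 NM1 a0 aM bN.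
have lr : l <= r.
  rewrite leNgt; apply/negP => /ltr_sinh; apply/negP; rewrite -leNgt.
  by rewrite -(ler_pM2l k0) kl kr ler_ln ?posrE// (lt_le_trans a0).
have aM12 := left_endpoint_le al0 M0 a0 aM.
have bN12 := right_endpoint_le al0 N0 bN.
have igl := has_Rintegral_left_majorant (S / (alpha * pi)) M k0 al0 a0 kl.
have igr := has_Rintegral_right_majorant (S / (alpha * pi)) N k0 al0 al1 kr.
apply: (@le_trans _ _ (eps / 4 + eps / 4)); last by clear; lra.
apply: le_trans (mx_integral_split lr (ccontinuous_F_DE alpha hA) igl igr _ _) _.
- by move=> x xl; apply: (F_DE_left_le hA al0 k0 c0 _ xl); rewrite kl.
- by move=> x rx; apply: (F_DE_right_le hA al0 k0 c0 _ rx); rewrite kr.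
apply: lerD.
- exact: left_tail_bound pi0 S0 al0 a0 aM12 aP.
- apply: (right_tail_bound pi0 S0 al0 al1 (expR_ge0 _) N0 bN12).
  exact: right_endpoint_decay al0 al1 Q0 bQ.
Qed.

Theorem proposition3p1 (R : realType) (n : nat) (A : 'M[R[i]]_n)
    (alpha eps : R)
    (hA : forall x : R, x <= 0 -> ~~ eigenvalue A x%:C)
    (halpha0 : 0 < alpha) (halpha1 : alpha < 1) (heps : 0 < eps) :
  let a : R := Num.min
    (eps / 4 * (pi * alpha * (1 + alpha)
                / (sin (alpha * pi) * (1 + 2 * alpha))))
    ((2 * mx_norm2 (invmx A)) `^ (- alpha)) in
  let b : R := Num.max
    ((eps / 4 * (pi * (1 - alpha) * (2 - alpha)
                 / (sin (alpha * pi) * (3 - 2 * alpha) * mx_norm2 A)))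
       `^ (alpha / (alpha - 1)))
    ((2 * mx_norm2 A) `^ alpha) in
  let l : R := asinh (2 * ln a / (alpha * pi)) in
  let r : R := asinh (2 * ln b / (alpha * pi)) in
  mx_norm2 (mx_integral [set: R] (F_DE A alpha)
            - mx_integral `[l, r] (F_DE A alpha)) <= eps / 2.
Proof.
cbv zeta.
have [n0|n0] := posnP n.
  (* In dimension 0 the norm of A is 0, so b is 0 and its logarithm carries no
     information; but the matrix to be bounded is 0 as well. *)
  have z0 (x : 'cV[R[i]]_n) : x = 0.
    by apply/colP => -[m mn]; exfalso; move: mn; rewrite n0.
  apply: mx_norm2_le => [|x]; first by rewrite divr_ge0// ltW.
  by rewrite (z0 (_ *m x)) vec_norm2_0 mulr_ge0 ?vec_norm2_ge0// divr_ge0// ltW.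
have pi0 : 0 < (pi : R) by exact: pi_gt0.
have ksinh y : alpha * pi / 2 * sinh (asinh (2 * y / (alpha * pi))) = y.
  rewrite asinhK; move: (pi : R) pi0 => p p0.
  by field; rewrite !gt_eqF.
apply: truncation_error_le (ksinh _) (ksinh _) => //.
- have ap0 : 0 < alpha * pi by rewrite mulr_gt0.
  have S0 : 0 < sin (alpha * pi) by apply: sin_gt0_pi; rewrite ap0 gtr_pMl.
  have M0 : 0 < mx_norm2 (invmx A).
    by rewrite mx_norm2_gt0// unitmx_inv (unitmx_of_eigenvalue hA).
  rewrite lt_min; apply/andP; split; last by rewrite powR_gt0 ?mulr_gt0.
  apply: mulr_gt0; first exact: divr_gt0.
  apply: divr_gt0.
    by apply: mulr_gt0 (mulr_gt0 pi0 halpha0) _; rewrite addr_gt0.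
  by apply: mulr_gt0 S0 _; rewrite addr_gt0// mulr_gt0.
- by rewrite ge_min lexx.
- by rewrite ge_min lexx orbT.
- by rewrite le_max lexx.
- by rewrite le_max lexx orbT.
Qed.
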